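(* Let $0<\lambda\le\Lambda$, $\rho=\Lambda/\lambda$, and let $n\in\mathbb{N}$. Let $f_n$ be the strategy defined in the context, with parameters $a_0,\dots,a_{n-1}$ and $a_n=\rho$. Then: (1) for all $0\le i<n$, $a_i=p_i(a_0)$; (2) $a_0$ is the unique solution of the equation $p_n(x)=\rho$ satisfying $x>\alpha_n$; (3) $a_n=p_n(a_0)=\rho$; (4) $CR(f_n)=2a_0+1$.
   Context: Search on a line: fix reals $0<\lambda\le\Lambda$ and put $\rho=\Lambda/\lambda\ge 1$. A searcher starts at the origin of the real line; a target lies at unknown distance $D\in[\lambda,\Lambda]$ from the origin on an unknown side. A search strategy is a function $f:\mathbb{N}\to\mathbb{R}^+$ ($\mathbb{N}=\{0,1,2,\dots\}$): in iteration $i=0,1,2,\dots$ the searcher walks distance $f(i)$ from the origin, alternating directions (right for even $i$, left for odd $i$), and returns to the origin, until it reaches the target. For $D>0$ let $f^{-1}(D)$ be the smallest $j$ with $f(j)\ge D$, and let $\phi(f,D)=2\sum_{i=0}^{f^{-1}(D)}f(i)+D$. The competitive ratio is $CR(f)=\sup_{D\in[\lambda,\Lambda]}\phi(f,D)/D$. Polynomials: $p_0(x)=x$, $p_1(x)=x(x-1)$, and $p_i(x)=x\,(p_{i-1}(x)-p_{i-2}(x))$ for $i\ge 2$; $\alpha_i$ denotes the largest real root of $p_i$. The strategy $f_n$: set $a_n:=\rho$; $f_n(i)=a_i\lambda$ for $0\le i<n$ and $f_n(i)=\rho\lambda=\Lambda$ for $i\ge n$, where for $n\ge1$ the reals $1\le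 a_0\le a_1\le\cdots\le a_{n-1}\le\rho$ are such that the worst-case ratio is equal on every subinterval $[\lambda,a_0\lambda],(a_0\lambda,a_1\lambda],\dots,(a_{n-1}\lambda,\rho\lambda]$, i.e. they satisfy $1+2\sum_{k=0}^{i+1}a_k/a_i=2a_0+1$ for $0\le i\le n-2$, and $1+2\sum_{k=0}^{n-1}a_k/a_{n-1}+2\rho/a_{n-1}=2a_0+1$. For $n=0$, $f_0(i)=\Lambda$ for all $i$ and $a_0=a_n=\rho$. *)

(* Defs.v *)
From HB Require Import structures.
From mathcomp Require Import all_boot all_order all_algebra.
From mathcomp Require Import all_classical all_reals all_analysis.
From mathcomp Require Import lra.
From mathcomp Require polyrcf.

Set Implicit Arguments.
Unset Strict Implicit.
Unset Printing Implicit Defensive.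

Import Order.TTheory GRing.Theory Num.Theory.
Import numFieldNormedType.Exports.

Local Open Scope classical_set_scope.
Local Open Scope ring_scope.

Section Search.
Variable R : realType.
Implicit Types (f a : nat -> R) (lambda Lambda rho D : R) (n i : nat).

(* [None] when no iteration of [f] goes as far as [D]. *)
Definition first_reach f D : option nat :=
  match pselect (exists j, D <= f j) with
  | left e => Some (ex_minn e)
  | right _ => None
  end.

(* A target that is never reached costs [+oo]. *)
Definition phi f D : \bar R :=
  if first_reach f D is Some j then (2 * (\sum_(i < j.+1) f i) + D)%:E
  else +oo%E.

Definition CR lambda Lambda f : \bar R :=
  ereal_sup [set (phi f D / D%:E)%E | D in `[lambda, Lambda]].

Fixpoint p_poly i : {poly R} :=
  match i with
  | 0 => 'X
  | k.+1 => match k with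
            | 0 => 'X * ('X - 1)
            | j.+1 => 'X * (p_poly k - p_poly j)
            end
  end.

Definition is_largest_root (p : {poly R}) (x : R) : Prop :=
  root p x /\ forall y, root p y -> y <= x.

(* The default value 0 of [xget] is never used: see [alphaP]. *)
Definition alpha i : R := xget 0 [set x | is_largest_root (p_poly i) x].

(* Only [a 0, ..., a n] matter; [a n] is rho, so the case [i = n.-1] of the
   monotonicity condition says that [a n.-1 <= rho]. *)
Definition fn_params rho n a : Prop :=
  a n = rho /\
  ((0 < n)%N ->
   [/\ 1 <= a 0%N,
       forall i, (i < n)%N -> a i <= a i.+1,
       forall i, (i.+1 < n)%N ->
         1 + 2 * (\sum_(k < i.+2) a k / a i) = 2 * a 0%N + 1
     & 1 + 2 * (\sum_(k < n) a k / a n.-1) + 2 * rho / a n.-1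
         = 2 * a 0%N + 1]).

Definition fn lambda rho n a : nat -> R :=
  fun i => if (i < n)%N then a i * lambda else rho * lambda.

Lemma fn_gt0 lambda rho n a i : 0 < lambda -> 1 <= rho ->
  fn_params rho n a -> 0 < fn lambda rho n a i.
Proof.
move=> l0 r1 [an h]; rewrite /fn; case: ifP => [lt_in|_].
  have n0 : (0 < n)%N by apply: leq_ltn_trans lt_in.
  have [a0 mono _ _] := h n0; rewrite mulr_gt0 //.
  apply: (lt_le_trans ltr01).
  elim: i lt_in => [//|i IH] lt_in.
  by rewrite (le_trans (IH (ltnW lt_in))) // mono // ltnW.
by rewrite mulr_gt0 // (lt_le_trans ltr01).
Qed.

Lemma p_poly_neq0 i : p_poly i != 0.
Proof.
have H : 0 < (p_poly i).[4] /\ 2 * (p_poly i).[4] <= (p_poly i.+1).[4].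
  elim: i => [|i [IH1 IH2]]; first by rewrite /= !hornerE; lra.
  split; first by lra.
  have -> : p_poly i.+2 = 'X * (p_poly i.+1 - p_poly i) by [].
  rewrite hornerM hornerX hornerD hornerN; lra.
by apply/eqP => p0; case: H; rewrite p0 horner0 ltxx.
Qed.

Lemma root_p_poly0 i : root (p_poly i) 0.
Proof.
by apply/rootP; case: i => [|[|i]]; rewrite /= ?hornerM hornerX ?mul0r.
Qed.

Lemma alphaP i : is_largest_root (p_poly i) (alpha i).
Proof.
apply: (@xgetPex _ 0 [set x | is_largest_root (p_poly i) x]).
have inr x : (x \in polyrcf.rootsR (p_poly i)) = root (p_poly i) x.
  by have := polyrcf.roots_on_rootsR (p_poly_neq0 i) x; rewrite in_itv.
exists (\big[Num.max/0]_(x <- polyrcf.rootsR (p_poly i)) x); split.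
  rewrite big_seq; apply: (big_ind (fun x => root (p_poly i) x)) =>
    [|x y rx ry|x].
  - exact: root_p_poly0.
  - by case: leP.
  - by rewrite inr.
move=> y; rewrite -inr => yr.
elim: (polyrcf.rootsR _) yr => // z s IH; rewrite inE big_cons le_max.
by case/predU1P => [->|/IH ->]; rewrite ?lexx ?orbT.
Qed.

End Search.

Arguments p_poly R i : clear implicits.
Arguments alpha R i : clear implicits.

(* Main.v *)
(** Clearing denominators, the equal-ratio equations say that
    [a 0 + ... + a i.+1 = a 0 * a i] for all [i < n] (with [a n = rho]).
    Subtracting consecutive ones gives the recurrence of the polynomials [p_i]
    at [a 0].  Where [p_0, ..., p_n] are all positive, the quotients
    [r_i = p_i.+1 / p_i] satisfy [r_i.+1 = x (1 - 1 / r_i)], so they are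
    nondecreasing in [x] and [p_n] is positive and increasing from there on;
    this gives [alpha_n < a 0].  Since [p_i.+2 (alpha_i.+1)] is nonpositive,
    the roots [alpha_i] are nondecreasing, so every [x > alpha_n] lies in that
    region and [p_n] is injective on it.  The competitive ratio is attained at
    [D = lambda]. *)

Require Import Defs.
From HB Require Import structures.
From mathcomp Require Import all_boot all_order all_algebra.
From mathcomp Require Import all_classical all_reals all_analysis.
From mathcomp Require Import lra.

Set Implicit Arguments.
Unset Strict Implicit.
Unset Printing Implicit Defensive.

Import Order.TTheory GRing.Theory Num.Theory.
Local Open Scope ring_scope.

(** * Growth and largest roots of the polynomials *)

Section PPoly.
Variable R : realType.
Implicit Types (x y : R) (i j n : nat).

Local Notation p i x := ((p_poly R i).[x]).

Lemma horner_p0 x : p 0%N x = x.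
Proof. by rewrite /= hornerX. Qed.

Lemma horner_p1 x : p 1%N x = x * (x - 1).
Proof. by rewrite /= !hornerE. Qed.

Lemma horner_pSS i x : p i.+2 x = x * (p i.+1 x - p i x).
Proof.
have -> : p_poly R i.+2 = 'X * (p_poly R i.+1 - p_poly R i) by [].
by rewrite hornerM hornerX hornerD hornerN.
Qed.

(* The first conjunct says that the quotient of [p i.+1] by [p i] increases
   from [x] to [y], the other two that so do [p i] and [p i.+1] divided by
   the variable. *)
Lemma p_ratio_le i x y : x <= y -> (forall j, (j <= i.+1)%N -> 0 < p j x) ->
  [/\ p i.+1 x * p i y <= p i.+1 y * p i x,
      p i x * y <= p i y * x & p i.+1 x * y <= p i.+1 y * x].
Proof.
move=> xy; elim: i => [|i IH] pos.
  have := pos 0%N isT; have := pos 1%N isT.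
  rewrite !horner_p1 !horner_p0 => x1 x0.
  have x1' : 0 < x - 1 by rewrite -(pmulr_rgt0 _ x0).
  have : 0 <= x * y * (y - x) by rewrite !mulr_ge0 //; lra.
  by split; lra.
have [j ji|h1 h2 h3] := IH; first by apply: pos; rewrite (leq_trans ji).
have x0 : 0 < x by have := pos 0%N isT; rewrite horner_p0.
have a0 : 0 < p i x by apply: pos; rewrite ltnW.
have b0 : 0 < p i.+1 x by apply: pos.
have c0 : 0 < p i.+2 x by apply: pos.
have ba : 0 < p i.+1 x - p i x by move: c0; rewrite horner_pSS pmulr_rgt0.
have y0 : 0 < y by exact: lt_le_trans xy.
have ay0 : 0 < p i y.
  by rewrite -(pmulr_lgt0 _ x0) (lt_le_trans _ h2) // mulr_gt0.
have by0 : 0 < p i.+1 y.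
  by rewrite -(pmulr_lgt0 _ x0) (lt_le_trans _ h3) // mulr_gt0.
have bay : 0 <= p i.+1 y - p i y.
  rewrite subr_ge0 -(ler_pM2r a0) (le_trans _ h1) // mulrC ler_pM2r //.
  by rewrite -subr_ge0 ltW.
have h4 : p i.+2 x * p i.+1 y <= p i.+2 y * p i.+1 x.
  rewrite !horner_pSS.
  (* The difference of the two sides is the sum of the quantities in [e1] and [e2]. *)
  have e1 : 0 <= x * (p i.+1 y * p i x - p i.+1 x * p i y).
    by rewrite mulr_ge0 ?subr_ge0 // ltW.
  have e2 : 0 <= (y - x) * ((p i.+1 y - p i y) * p i.+1 x).
    by rewrite mulr_ge0 ?subr_ge0 // mulr_ge0 // ltW.
  lra.
split=> //.
(* After multiplication by [p i.+1 x], the bound follows from [h3] and then [h4]. *)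
rewrite -(ler_pM2r b0).
apply: (@le_trans _ _ (p i.+2 x * p i.+1 y * x)).
  by rewrite -!mulrA ler_pM2l // [y * _]mulrC.
by rewrite [leRHS]mulrAC ler_pM2r.
Qed.

Lemma p_scaled_le n x y : x <= y -> (forall j, (j <= n)%N -> 0 < p j x) ->
  p n x * y <= p n y * x.
Proof.
move=> xy; case: n => [|n] pos; first by rewrite !horner_p0 mulrC.
by have [] := p_ratio_le xy pos.
Qed.

Lemma p_lt n x y : x < y -> (forall j, (j <= n)%N -> 0 < p j x) ->
  p n x < p n y.
Proof.
move=> xy pos; have x0 : 0 < x by have := pos 0%N isT; rewrite horner_p0.
rewrite -(ltr_pM2r x0) (lt_le_trans _ (p_scaled_le (ltW xy) pos)) //.
by rewrite ltr_pM2l // pos.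
Qed.

(** At a root at or beyond [x], [p_scaled_le] would bound a positive number by zero. *)
Lemma alpha_lt n x : (forall j, (j <= n)%N -> 0 < p j x) -> alpha R n < x.
Proof.
move=> pos; rewrite ltNge; apply/negP => xa.
have [/rootP r _] := alphaP R n.
have x0 : 0 < x by have := pos 0%N isT; rewrite horner_p0.
have := p_scaled_le xa pos; rewrite r mul0r leNgt mulr_gt0 ?pos //.
exact: lt_le_trans xa.
Qed.

(** The quotient bound [2 <= r] survives [r -> x * (1 - 1 / r)] because [4 * (1 - 1 / 2) = 2]. *)
Lemma p_gt0_ge4 i x : 4 <= x -> 0 < p i x.
Proof.
move=> x4; suff [] : 0 < p i x /\ 2 * p i x <= p i.+1 x by [].
elim: i => [|i [IH1 IH2]]; first by rewrite horner_p1 horner_p0; nra.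
split; first by lra.
rewrite horner_pSS; nra.
Qed.

(** Intermediate values up to [Num.max x 4], where [p i] is positive. *)
Lemma root_p_ge i x : p i x <= 0 -> exists2 z, x <= z & root (p_poly R i) z.
Proof.
move=> px; have xM : x <= Num.max x 4 by rewrite le_max lexx.
have pM : 0 <= p i (Num.max x 4).
  by rewrite ltW // p_gt0_ge4 // le_max lexx orbT.
have [|z zI rz] := @poly_ivt _ (p_poly R i) _ _ xM; first by rewrite px pM.
by exists z => //; move: zI; case/andP.
Qed.

Lemma p_gt0 i x : alpha R i < x -> 0 < p i x.
Proof.
move=> ax; rewrite ltNge; apply/negP => /root_p_ge[z xz rz].
have [_ /(_ _ rz)] := alphaP R i.
by rewrite leNgt (lt_le_trans ax xz).
Qed.

Lemma p_ge0 i x : alpha R i <= x -> 0 <= p i x.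
Proof.
rewrite le_eqVlt => /predU1P[<-|/p_gt0/ltW//].
by have [/rootP ->] := alphaP R i.
Qed.

Lemma alpha_ge0 i : 0 <= alpha R i.
Proof. by have [_ ->] := alphaP R i; rewrite ?root_p_poly0. Qed.

Lemma alpha_leS i : alpha R i <= alpha R i.+1.
Proof.
suff : p i.+1 (alpha R i) <= 0.
  by move=> /root_p_ge[z az rz]; have [_ /(_ _ rz)] := alphaP R i.+1;
     apply: le_trans.
elim: i => [|i IH].
  have [/rootP + _] := alphaP R 0; rewrite horner_p0 => ->.
  by rewrite horner_p1 mul0r.
have [/rootP r _] := alphaP R i.+1.
(* At a root [x] of [p i.+1] the recurrence leaves [- (x * p i x)]. By induction [alpha R i.+1] is
   at least [alpha R i], so [p i] is nonnegative there. *)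
rewrite horner_pSS r sub0r mulrN oppr_le0 mulr_ge0 ?alpha_ge0 // p_ge0 //.
have [z az rz] := root_p_ge IH.
by have [_ /(_ _ rz)] := alphaP R i.+1; apply: le_trans.
Qed.

Lemma alpha_le i n : (i <= n)%N -> alpha R i <= alpha R n.
Proof.
elim: n => [|n IH]; first by rewrite leqn0 => /eqP ->.
rewrite leq_eqVlt => /predU1P[->//|]; rewrite ltnS => /IH h.
exact: le_trans h (alpha_leS n).
Qed.

Lemma p_inj_gt_alpha n x y : alpha R n < x -> alpha R n < y ->
  p n x = p n y -> x = y.
Proof.
(* Monotonicity of the largest roots gives positivity of all earlier [p j] too, as [p_lt]
   requires. *)
have pos z : alpha R n < z -> forall j, (j <= n)%N -> 0 < p j z.
  by move=> az j jn; apply: p_gt0; apply: le_lt_trans az; apply: alpha_le.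
move=> /pos ax /pos ay e.
by case: (ltgtP x y) => // /p_lt => [/(_ n ax)|/(_ n ay)]; rewrite e ltxx.
Qed.

End PPoly.

(** * Solutions of the equal-ratio equations and their strategies *)

Section Params.
Variables (R : realType) (rho : R) (n : nat) (a : nat -> R).
Hypotheses (rho_ge1 : 1 <= rho) (a_params : fn_params rho n a).

Lemma params_a0_ge1 : 1 <= a 0%N.
Proof.
have [an h] := a_params; case: n an h => [->//|m] _ h.
by have [] := h isT.
Qed.

Lemma params_ge1 i : (i <= n)%N -> 1 <= a i.
Proof.
have [an h] := a_params.
elim: i => [|i IH] lt_in; first exact: params_a0_ge1.
have [_ mono _ _] := h (leq_ltn_trans (leq0n i) lt_in).
by rewrite (le_trans (IH (ltnW lt_in))) // mono.
Qed.

Lemma params_sum i : (i < n)%N -> \sum_(k < i.+2) a k = a 0%N * a i.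
Proof.
have [an h] := a_params => lt_in.
have [_ _ eqs eqn] := h (leq_ltn_trans (leq0n i) lt_in).
have ai0 : a i != 0.
  by rewrite gt_eqF // (lt_le_trans ltr01) // params_ge1 1?ltnW.
suff e : (\sum_(k < i.+2) a k) / a i = a 0%N by rewrite -{1}e divfK.
(* For [i.+1 = n] the last equation applies, its [rho] being the missing summand [a n]. *)
move: lt_in; rewrite leq_eqVlt => /predU1P[ein|lt_in].
  move: eqn; rewrite -an -ein /= -mulr_suml => eqn.
  rewrite big_ord_recr /= mulrDl; lra.
by have := eqs i lt_in; rewrite -mulr_suml; lra.
Qed.

Lemma params_p i : (i <= n)%N -> a i = (p_poly R i).[a 0%N].
Proof.
(* The recurrence has order two, so the induction carries two consecutive indices. *)
suff [] : ((i <= n)%N -> a i = (p_poly R i).[a 0%N]) /\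
          ((i < n)%N -> a i.+1 = (p_poly R i.+1).[a 0%N]) by [].
elim: i => [|i [IH1 IH2]].
  split=> [_|/params_sum]; first by rewrite horner_p0.
  by rewrite !big_ord_recr big_ord0 /= horner_p1; lra.
split=> // lt_in; have := params_sum lt_in.
rewrite big_ord_recr /= params_sum 1?ltnW // horner_pSS.
rewrite -IH2 1?ltnW // -IH1 1?ltnW 1?ltnW //; lra.
Qed.

Lemma fn_le_n lambda i : (i <= n)%N -> fn lambda rho n a i = a i * lambda.
Proof.
have [an _] := a_params; rewrite leq_eqVlt /fn => /predU1P[->|->//].
by rewrite ltnn an.
Qed.

Lemma first_reach_fn lambda D : 0 < lambda -> D <= rho * lambda ->
  exists2 j, first_reach (fn lambda rho n a) D = Some j &
    [/\ (j <= n)%N, D <= a j * lambda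
      & forall i, (i < j)%N -> a i * lambda < D].
Proof.
move=> l0 Dr; have [an _] := a_params.
(* Iteration [n] goes as far as [rho * lambda], which rules out [None]. *)
have Dn : D <= fn lambda rho n a n by rewrite fn_le_n // an.
rewrite /first_reach; case: pselect => [e|[]]; last by exists n.
case: ex_minnP => j Dj jmin; exists j => //.
have jn : (j <= n)%N by apply: jmin.
split=> // [|i ij]; first by rewrite -fn_le_n.
rewrite -fn_le_n; last by rewrite (leq_trans (ltnW ij)).
by rewrite ltNge; apply/negP => /jmin; rewrite leqNgt ij.
Qed.

Lemma CR_fn lambda : 0 < lambda ->
  CR lambda (rho * lambda) (fn lambda rho n a) = (2 * a 0%N + 1)%:E.
Proof.
move=> l0; apply/eqP; rewrite eq_le; apply/andP; split.
  apply: ge_ereal_sup => z [D /=]; rewrite in_itv /= => /andP[lD Dr] <-.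
  have D0 : 0 < D by apply: lt_le_trans lD.
  have [j rj [jn Dj below]] := first_reach_fn l0 Dr.
  rewrite /phi rj inver gt_eqF // -EFinM lee_fin ler_pdivrMr //.
  have -> : \sum_(i < j.+1) fn lambda rho n a i =
            (\sum_(i < j.+1) a i) * lambda.
    rewrite mulr_suml; apply: eq_bigr => i _.
    by rewrite fn_le_n // (leq_trans _ jn) // -ltnS.
  rewrite [leRHS]mulrDl mul1r lerD2r -mulrA ler_pM2l //.
  have a0 : 0 < a 0%N by rewrite (lt_le_trans ltr01) // params_a0_ge1.
  (* If [D] is first reached at [i.+1], the sum is [a 0 * a i] and [a i * lambda < D]; if at 0, it
     is [a 0] and [lambda <= D]. *)
  case: j rj jn Dj below => [|i] rj jn Dj below.
    by rewrite big_ord_recr big_ord0 /= add0r ler_pM2l.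
  by rewrite params_sum // -mulrA ler_pM2l // ltW // below.
have lr : lambda <= rho * lambda by rewrite ler_peMl // ltW.
apply: ereal_sup_ubound => /=; exists lambda.
  by rewrite /= in_itv /= lexx.
(* As [1 <= a 0], the distance [lambda] is reached in iteration 0. *)
have [[|j] rj [_ _ below]] := first_reach_fn l0 lr; last first.
  by have := below 0%N isT; rewrite ltNge ler_peMl ?params_a0_ge1 // ltW.
rewrite /phi rj inver gt_eqF // -EFinM big_ord_recr big_ord0 /= fn_le_n //.
by congr (_%:E); rewrite add0r mulrDl mulrA mulfK ?divff // gt_eqF.
Qed.

End Params.

Theorem theorem1 (R : realType) (lambda Lambda rho : R) (n : nat)
    (a : nat -> R)
    (lambda_gt0 : 0 < lambda) (lambda_le : lambda <= Lambda)
    (rhoE : rho = Lambda / lambda)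
    (a_params : fn_params rho n a) :
  [/\ forall i : nat, (i < n)%N -> a i = (p_poly R i).[a 0%N],
      [/\ (p_poly R n).[a 0%N] = rho, alpha R n < a 0%N
        & forall x : R, (p_poly R n).[x] = rho -> alpha R n < x -> x = a 0%N],
      a n = (p_poly R n).[a 0%N] /\ (p_poly R n).[a 0%N] = rho
    & CR lambda Lambda (fn lambda rho n a) = (2 * a 0%N + 1)%:E].
Proof.
have rho_ge1 : 1 <= rho by rewrite rhoE ler_pdivlMr // mul1r.
have LambdaE : Lambda = rho * lambda by rewrite rhoE divfK // gt_eqF.
have aE := params_p rho_ge1 a_params.
have pn : (p_poly R n).[a 0%N] = rho by rewrite -aE //; case: a_params.
have an : alpha R n < a 0%N.
  (* Each earlier polynomial takes the value [a j >= 1] at [a 0]. *)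
  apply: alpha_lt => j jn; rewrite -aE //.
  by rewrite (lt_le_trans ltr01) // (params_ge1 rho_ge1 a_params).
split.
- by move=> i /ltnW/aE.
- by split=> // x px ax; apply: (@p_inj_gt_alpha _ n) => //; rewrite px pn.
- by split=> //; apply: aE.
- by rewrite LambdaE CR_fn.
Qed.
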